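(* Let $G$ be a finite simple graph with vertex set $V(G)=\{t_1,\ldots,t_s\}$ and at least one edge, let $S=K[t_1,\ldots,t_s]$ be a polynomial ring over a field $K$, and let $I_c(G)\subset S$ be the ideal of covers of $G$. If the independence complex $\Delta_G$ of $G$ is pure and shellable, then $$\mathrm{v}(I_c(G))=\mathrm{reg}(S/I_c(G))=\alpha_0(G)-1.$$
   Context: A vertex cover of $G$ is a set of vertices meeting every edge; it is minimal if minimal with respect to inclusion. $\alpha_0(G)$ is the smallest cardinality of a vertex cover of $G$. The ideal of covers $I_c(G)$ is generated by the monomials $t_c=\prod_{t_i\in c}t_i$ with $c$ a minimal vertex cover of $G$. The independence complex $\Delta_G$ is the simplicial complex whose faces are the stable sets of $G$ (sets of pairwise non-adjacent vertices). It is pure if all its facets (maximal faces) have the same size. It is shellable if its facets can be ordered $F_1,\ldots,F_r$ such that for all $1\leq i<j\leq r$ there exist $v\in F_j\setminus F_i$ and $\ell\in\{1,\ldots,j-1\}$ with $F_j\setminus F_\ell=\{v\}$. With the standard grading $S=\bigoplus_{d\ge0}S_d$, for a proper squarefree monomial ideal $I\subset S$ the v-number is $\mathrm{v}(I)=\min\{d\geq 0\mid \exists f\in S_d\text{ and }\mathfrak{p}\in\mathrm{Ass}(I)\text{ with }(I\colon f)=\mathfrak{p}\}$, where $\mathrm{Ass}(I)$ is the set of associated primes of $S/I$; in particular $\mathrm{v}(I)=0$ if $I$ is prime. The regularity of $S/I$ is $\mathrm{reg}(S/I)=\max\{j-i\mid b_{i,j}\neq0\}$, where $b_{i,j}$ are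 the graded Betti numbers of the minimal graded free resolution of $S/I$ over $S$. *)

(* Defs.v *)
From HB Require Import structures.
From mathcomp Require Import all_boot all_order all_algebra.
From mathcomp Require Import ring_quotient.
From mathcomp Require Import mpoly.

Set Implicit Arguments.
Unset Strict Implicit.
Unset Printing Implicit Defensive.

Import GRing.Theory.

Section Graphs.
Variables (V : finType) (e : rel V).

Definition vertex_cover (C : {set V}) : bool :=
  [forall x, forall y, e x y ==> (x \in C) || (y \in C)].

Definition min_vertex_cover (C : {set V}) : bool := minset vertex_cover C.

Definition alpha0 : nat := #|[arg min_(C < [set: V] | vertex_cover C) #|C|]|.

Definition stable (A : {set V}) : bool :=
  [forall x in A, forall y in A, ~~ e x y].

Definition independence_complex : {set {set V}} := [set A | stable A].

End Graphs.

Section Complexes.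
Variables (V : finType) (D : {set {set V}}).

Definition facets : {set {set V}} := [set F | maxset (mem D) F].

Definition pure : Prop := {in facets &, forall F H : {set V}, #|F| = #|H|}.

Definition shelling (F : seq {set V}) : Prop :=
  forall i j, i < j < size F ->
  exists2 v, v \in nth set0 F j :\: nth set0 F i &
  exists2 l, l < j & nth set0 F j :\: nth set0 F l = [set v].

Definition shellable : Prop :=
  exists F : seq {set V}, [/\ uniq F, F =i facets & shelling F].

End Complexes.

Local Open Scope ring_scope.

Section Ideals.
Variable R : comNzRingType.
Implicit Types (I gens : R -> Prop) (p : {pred R}).

Definition ideal_gen gens : R -> Prop := fun f =>
  exists (m : nat) (c g : 'I_m -> R),
    (forall i, gens (g i)) /\ f = \sum_i c i * g i.

Definition colon I (f : R) : R -> Prop := fun g => I (g * f).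

(* [idealr_closed] includes properness. Prime ideals are decidable predicates
   because the library's notion is stated for those; classically this is no
   restriction. *)
Definition prime_ideal p : Prop := idealr_closed p /\ prime_idealr_closed p.

(* p is an associated prime of R / I, i.e. the annihilator of the class of
   some g. *)
Definition associated_prime I p : Prop :=
  prime_ideal p /\ exists g, forall f, colon I g f <-> f \in p.

End Ideals.

Section GradedAlgebra.
Variables (K : fieldType) (n : nat).
Local Notation S := {mpoly K[n]}.
Implicit Types I : S -> Prop.

Definition cover_ideal (e : rel 'I_n) : S -> Prop :=
  ideal_gen (fun t => exists2 C, min_vertex_cover e C & t = \prod_(i in C) 'X_i).

Definition v_witness I (d : nat) : Prop :=
  exists2 f : S, f \is d.-homog &
  exists2 p : {pred S}, associated_prime I p &
    forall g, colon I f g <-> g \in p.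

Definition is_v_number I (d : nat) : Prop :=
  v_witness I d /\ forall d', v_witness I d' -> (d <= d')%N.

(* Membership in the graded piece S_j for j in Z; S_j = 0 for j < 0. *)
Definition in_degree (j : int) (f : S) : Prop :=
  if j is Posz d then f \is d.-homog else f = 0.

(* Data of an augmented complex of graded free S-modules
     ... -> F_2 -> F_1 -> F_0 -> S / I,
   F_i being the direct sum of the S(- shift i k) for k < rank i. Elements of
   F_i are row vectors, [diff i] : F_(i+1) -> F_i acts on them by right
   multiplication, and [aug k] is a representative in S of the image of the
   k-th basis element of F_0. *)
Record graded_free_data := GradedFreeData {
  rank : nat -> nat;
  shift : forall i, 'I_(rank i) -> int;
  diff : forall i, 'M[S]_(rank i.+1, rank i);
  aug : 'cV[S]_(rank 0)
}.

Implicit Type F : graded_free_data.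

Definition graded_maps F : Prop :=
  (forall i k l, in_degree (shift k - shift l) (diff F i k l)) /\
  (forall k, in_degree (shift k) (aug F k 0)).

Definition exact_over I F : Prop :=
  [/\ forall f : S, exists v : 'rV_(rank F 0), I (f - (v *m aug F) 0 0),
      forall v : 'rV_(rank F 0),
        I ((v *m aug F) 0 0) <-> exists w, v = w *m diff F 0
    & forall i (v : 'rV_(rank F i.+1)),
        v *m diff F i = 0 <-> exists w, v = w *m diff F i.+1].

(* Every differential maps F_(i+1) into m F_i, where m is the ideal generated
   by the variables. *)
Definition minimal F : Prop := forall i k l, (diff F i k l)@_0%MM = 0.

Definition minimal_graded_free_resolution I F : Prop :=
  [/\ graded_maps F, exact_over I F & minimal F].

Definition num_shifts F (i : nat) (j : int) : nat :=
  #|[set k : 'I_(rank F i) | shift k == j]|.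

(* b i j is the multiplicity of S(-j) in the i-th term of the minimal graded
   free resolution of S / I: such a resolution exists, and b does not depend
   on the choice of it. *)
Definition graded_betti I (b : nat -> int -> nat) : Prop :=
  (exists F, minimal_graded_free_resolution I F) /\
  (forall F, minimal_graded_free_resolution I F ->
     forall i j, b i j = num_shifts F i j).

Definition is_regularity I (r : int) : Prop :=
  exists2 b, graded_betti I b &
    (exists i j, b i j <> 0%N /\ r = j - i%:Z) /\
    (forall i j, b i j <> 0%N -> j - i%:Z <= r).

End GradedAlgebra.

(* Main.v *)
(* Complementation exchanges facets of the independence complex and minimal
   vertex covers, so I is generated by the monomials m_j = t^(complement of F_j)
   for a shelling F_1, ..., F_r, and by purity these all have degree
   a = alpha_0(G). The shelling condition says that each colon ideal
   (m_1, ..., m_(j-1)) : m_j is generated by variables. Taking iterated mapping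
   cones, first for ideals of variables (Koszul complexes) and then for the m_j,
   gives a graded resolution of S/I whose i-th term, i >= 1, is generated in
   degree i + a - 1. It is minimal for degree reasons, and Betti numbers do not
   depend on the resolution since chain maps lifting the identity are homotopic;
   hence the regularity is a - 1.

   If (I : f) is a prime p, it contains a variable t_i dividing some generator,
   so t_i f is a nonzero element of I and deg f >= a - 1. Conversely F_1 and F_2
   differ by exchanging the ends u, v of an edge, and for f the product of the
   variables outside F_1 and F_2 one gets (I : f) = (t_u, t_v). *)

From HB Require Import structures.
From Stdlib Require Import IndefiniteDescription.
From mathcomp Require Import ring_quotient mpoly.
Require Import Defs.
From mathcomp Require Import all_boot all_order all_algebra.

Set Implicit Arguments.
Unset Strict Implicit.
Unset Printing Implicit Defensive.

Import GRing.Theory Num.Theory.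

Local Open Scope ring_scope.

(** * Homogeneous components in integer degrees *)

Section HomogeneousComponents.
Variables (K : fieldType) (n : nat).
Local Notation S := {mpoly K[n]}.
Implicit Types (f g : S) (i j : int).

(** Degrees are integers because the shifts of a resolution are; every component of negative degree
    is 0. *)
Definition hcomp (j : int) (f : S) : S :=
  if j is Posz d then pihomog mdeg d f else 0.

Lemma hcomp_is_linear j : linear (hcomp j).
Proof. by case: j => d c f g /=; [rewrite linearP | rewrite scaler0 addr0]. Qed.

HB.instance Definition _ j := GRing.isLinear.Build K S S _ (hcomp j) (hcomp_is_linear j).

Lemma in_degree_hcomp j f : in_degree j (hcomp j f).
Proof. by case: j => d //=; apply: pihomogP. Qed.

Lemma hcomp_id j f : in_degree j f -> hcomp j f = f.
Proof. by case: j => d /= => [/pihomog_dE|->]. Qed.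

Lemma hcomp_neq i j f : i != j -> in_degree i f -> hcomp j f = 0.
Proof.
case: i => i /= => [|_ ->]; last by rewrite raddf0.
by case: j => // j ne_ij fi; apply: (pihomog_ne0 _ fi); apply: contra ne_ij => /eqP->.
Qed.

Lemma in_degree0 j : in_degree j (0 : S).
Proof. by case: j => d //=; apply: dhomog0. Qed.

Lemma in_degreeD j f g : in_degree j f -> in_degree j g -> in_degree j (f + g).
Proof. by case: j => d /=; [exact: dhomogD | move=> -> ->; rewrite addr0]. Qed.

Lemma in_degreeN j f : in_degree j f -> in_degree j (- f).
Proof. by case: j => d /=; [rewrite dhomogN | move=> ->; rewrite oppr0]. Qed.

Lemma in_degreeM i j f g : in_degree i f -> in_degree j g -> in_degree (i + j) (f * g).
Proof.
case: i => i /= => [fi|->]; last by rewrite mul0r => _; apply: in_degree0.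
case: j => j /= => [gj|->]; last by rewrite mulr0; apply: in_degree0.
exact: dhomogM.
Qed.

Lemma in_degree_sum j (I : finType) (F : I -> S) :
  (forall k, in_degree j (F k)) -> in_degree j (\sum_k F k).
Proof.
by move=> Fj; elim/big_ind: _ => //; [exact: in_degree0 | move=> *; exact: in_degreeD].
Qed.

Lemma in_degree1 : in_degree 0 (1 : S).
Proof. exact: dhomog1. Qed.

(** By linearity [f] may be taken to be a monomial, and then [f * g] is homogeneous. *)
Lemma hcompM i j f g : in_degree i g -> hcomp j (f * g) = hcomp (j - i) f * g.
Proof.
move=> gi; elim/mpolyind: f => [|c m f _ _ IH]; first by rewrite mul0r !raddf0 mul0r.
rewrite mulrDl !linearD /= IH mulrDl; congr (_ + _).
rewrite -scalerAl !linearZ /= -scalerAl; congr (_ *: _).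
have Xm : in_degree (mdeg m) ('X_[m] : S) by rewrite /= dhomogX.
have Xg := in_degreeM Xm gi.
have [<-|ne_ij] := eqVneq (Posz (mdeg m) + i) j; first by rewrite addrK !hcomp_id.
rewrite (hcomp_neq ne_ij Xg) (hcomp_neq _ Xm) ?mul0r //.
by apply: contra ne_ij => /eqP->; rewrite subrK.
Qed.

Lemma mcoeff0_in_degree j f : j != 0 -> in_degree j f -> f@_0%MM = 0.
Proof.
case: j => d /= => [|_ ->]; last by rewrite mcoeff0.
by move=> d0 fd; apply: (dhomog_nemf_coeff fd); rewrite mf0; apply: contra d0 => /eqP <-.
Qed.

(** Matrices of degree-preserving maps from the sum of the S(-a k) to the sum of the S(-b l), acting
    on row vectors. *)
Definition homog_mx p q (a : 'I_p -> int) (b : 'I_q -> int) (A : 'M[S]_(p, q)) :=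
  forall k l, in_degree (a k - b l) (A k l).

Definition hcomp_mx p q (a : 'I_p -> int) (b : 'I_q -> int) (A : 'M[S]_(p, q)) :=
  \matrix_(k, l) hcomp (a k - b l) (A k l).

Lemma homog_hcomp_mx p q (a : 'I_p -> int) (b : 'I_q -> int) A :
  homog_mx a b (hcomp_mx a b A).
Proof. by move=> k l; rewrite mxE; apply: in_degree_hcomp. Qed.

Lemma hcomp_mx_id p q (a : 'I_p -> int) (b : 'I_q -> int) A :
  homog_mx a b A -> hcomp_mx a b A = A.
Proof. by move=> Aab; apply/matrixP=> k l; rewrite mxE hcomp_id. Qed.

Lemma hcomp_mxM p q r (a : 'I_p -> int) (b : 'I_q -> int) (c : 'I_r -> int) A B :
  homog_mx b c B -> hcomp_mx a c (A *m B) = hcomp_mx a b A *m B.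
Proof.
move=> Bbc; apply/matrixP=> k l; rewrite !mxE raddf_sum; apply: eq_bigr => i _.
by rewrite mxE /= (hcompM _ _ (Bbc i l)) opprB addrA subrK.
Qed.

Lemma homog_mxM p q r (a : 'I_p -> int) (b : 'I_q -> int) (c : 'I_r -> int) A B :
  homog_mx a b A -> homog_mx b c B -> homog_mx a c (A *m B).
Proof.
move=> Aab Bbc k l; rewrite mxE; apply: in_degree_sum => i.
by have := in_degreeM (Aab k i) (Bbc i l); rewrite addrA subrK.
Qed.

Lemma homog_mx_shift p q (a : 'I_p -> int) (b : 'I_q -> int) (c : int) A :
  homog_mx a b A -> homog_mx (fun k => a k + c) (fun l => b l + c) A.
Proof. by move=> Aab k l; rewrite opprD addrACA subrr addr0; apply: Aab. Qed.

Lemma rows_mulmx p q r (A : 'M[S]_(p, q)) (D : 'M[S]_(r, q)) :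
  (forall k, exists w, row k A = w *m D) -> exists W, A = W *m D.
Proof.
move=> /fin_all_exists[w wP]; exists (\matrix_k w k); apply/row_matrixP=> k.
by rewrite row_mul rowK.
Qed.

(** The homogeneous part of any solution [W] is again a solution, since [A] and [D] are
    homogeneous. *)
Lemma homog_factor p q r (a : 'I_p -> int) (b : 'I_q -> int) (c : 'I_r -> int)
    (A : 'M[S]_(p, r)) (D : 'M[S]_(q, r)) :
  homog_mx a c A -> homog_mx b c D -> (exists W, A = W *m D) ->
  exists2 W, A = W *m D & homog_mx a b W.
Proof.
move=> Aac Dbc [W AW]; exists (hcomp_mx a b W); last exact: homog_hcomp_mx.
by rewrite -(hcomp_mxM _ _ Dbc) -AW hcomp_mx_id.
Qed.

End HomogeneousComponents.

(** Serves to build chain maps degree by degree; the invariant [P] guarantees that the next step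
    exists. *)
Lemma dependent_choice (T : nat -> Type) (P : forall i, T i -> Prop)
    (R : forall i, T i -> T i.+1 -> Prop) (x0 : T 0) :
  P 0 x0 -> (forall i x, P i x -> exists2 y, P i.+1 y & R i x y) ->
  exists f : forall i, T i,
    [/\ f 0 = x0, forall i, P i (f i) & forall i, R i (f i) (f i.+1)].
Proof.
move=> Px0 step.
have step' i (x : {x | P i x}) : exists y : {y | P i.+1 y}, R i (sval x) (sval y).
  by case: x => x Px; have [y Py Rxy] := step i x Px; exists (exist _ y Py).
pose next i x := constructive_indefinite_description _ (step' i x).
pose f := fix f i : {x | P i x} :=
  if i is i'.+1 then sval (next i' (f i')) else exist _ x0 Px0.
exists (fun i => sval (f i)); split=> // i; first exact: (svalP (f i)).
exact: (svalP (next i (f i))).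
Qed.

(** * Ideals as predicates *)

Section Ideals.
Variable R : comNzRingType.
Implicit Types I : R -> Prop.

(** Unlike [idealr_closed], this admits the unit ideal, which can occur as a colon ideal. *)
Definition is_ideal I := I 0 /\ forall a f g, I f -> I g -> I (a * f + g).

Lemma ideal0 I : is_ideal I -> I 0. Proof. by case. Qed.

Lemma idealMD I a f g : is_ideal I -> I f -> I g -> I (a * f + g).
Proof. by case=> _; apply. Qed.

Lemma idealD I f g : is_ideal I -> I f -> I g -> I (f + g).
Proof. by move=> idI If Ig; rewrite -[f]mul1r; apply: idealMD. Qed.

Lemma idealMl I a f : is_ideal I -> I f -> I (a * f).
Proof. by move=> idI If; rewrite -[a * f]addr0; apply: idealMD => //; apply: ideal0. Qed.

Lemma idealN I f : is_ideal I -> I f -> I (- f).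
Proof. by move=> idI If; rewrite -mulN1r; apply: idealMl. Qed.

Lemma idealB I f g : is_ideal I -> I f -> I g -> I (f - g).
Proof. by move=> idI If Ig; apply: idealD => //; apply: idealN. Qed.

Lemma ideal_congr I f g : is_ideal I -> I (f - g) -> I f <-> I g.
Proof.
move=> idI Ifg; split=> [If|Ig]; last by rewrite -[f](subrK g); apply: idealD.
by rewrite -[g](subKr f); apply: idealB.
Qed.

Lemma ideal_sum I (T : finType) (F : T -> R) :
  is_ideal I -> (forall k, I (F k)) -> I (\sum_k F k).
Proof.
by move=> idI IF; elim/big_ind: _ => //; [exact: ideal0 | move=> f g; exact: idealD].
Qed.

Lemma ideal_mulmx I p q r (A : 'M_(p, q)) (B : 'M_(q, r)) :
  is_ideal I -> (forall k l, I (B k l)) -> forall k l, I ((A *m B) k l).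
Proof.
by move=> idI IB k l; rewrite mxE; apply: ideal_sum => // i; apply: idealMl.
Qed.

End Ideals.

(** * Comparison of resolutions and uniqueness of Betti numbers *)

Section Comparison.
Variables (K : fieldType) (n : nat).
Local Notation S := {mpoly K[n]}.
Implicit Types (I J : S -> Prop) (F G : graded_free_data K n).

Definition homogeneous_ideal I := forall j f, I f -> I (hcomp j f).

Lemma exact_aug_surj I F p (A : 'M[S]_(p, 1)) : exact_over I F ->
  exists W : 'M_(p, rank F 0), forall k l, I ((A - W *m aug F) k l).
Proof.
case=> surjF _ _.
have /fin_all_exists[w wP] k : exists v : 'rV_(rank F 0), I (A k 0 - (v *m aug F) 0 0).
  exact: surjF.
exists (\matrix_k w k) => k l; rewrite ord1.
have := wP k; rewrite !mxE; congr (I (_ - _)).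
by apply: eq_bigr => i _; rewrite mxE.
Qed.

Lemma exact_aug_ker I F p (A : 'M[S]_(p, rank F 0)) : exact_over I F ->
  (forall k l, I ((A *m aug F) k l)) -> exists W, A = W *m diff F 0.
Proof.
case=> _ kerF _ IA; apply: rows_mulmx => k; apply/kerF.
by have := IA k 0; rewrite -row_mul [row _ _ _ _]mxE.
Qed.

Lemma exact_ker I F i p (A : 'M[S]_(p, rank F i.+1)) : exact_over I F ->
  A *m diff F i = 0 -> exists W, A = W *m diff F i.+1.
Proof.
case=> _ _ kerF A0; apply: rows_mulmx => k; apply/kerF.
by rewrite -row_mul A0 row0.
Qed.

Lemma exact_diff_aug I F : exact_over I F -> forall k l, I ((diff F 0 *m aug F) k l).
Proof.
case=> _ kerF _ k l; rewrite ord1.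
have /kerF : exists w, row k (diff F 0) = w *m diff F 0.
  by exists (delta_mx 0 k); rewrite rowE.
by rewrite -row_mul [row _ _ _ _]mxE.
Qed.

Lemma exact_diffM I F i : exact_over I F -> diff F i.+1 *m diff F i = 0.
Proof.
case=> _ _ kerF; apply/row_matrixP => k; rewrite row_mul row0; apply/kerF.
by exists (delta_mx 0 k); rewrite rowE.
Qed.

(* phi is a chain map from G, twisted by a, to F lifting the multiplication by m. *)
Definition lifts_mul I (m : S) (a : int) F G
    (phi : forall i, 'M[S]_(rank G i, rank F i)) :=
  [/\ forall i, homog_mx (fun k => shift k + a) (@shift K n F i) (phi i),
      forall k l, I ((m *: aug G - phi 0 *m aug F) k l)
    & forall i, diff G i *m phi i = phi i.+1 *m diff F i].

(** Each [phi i.+1] comes from factoring [diff G i *m phi i] through [diff F i] by exactness and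
    keeping the homogeneous part of the factor. *)
Lemma comparison I J (m : S) (a : int) F G :
  is_ideal I -> homogeneous_ideal I -> in_degree a m ->
  (forall f, J f -> I (f * m)) ->
  graded_maps F -> exact_over I F -> graded_maps G -> exact_over J G ->
  exists phi : forall i, 'M_(rank G i, rank F i), lifts_mul I m a phi.
Proof.
move=> idI homI ma JI [dF aF] exF [dG aG] exG.
have dG' i : homog_mx (fun k => shift k + a) (fun k => shift k + a) (diff G i).
  exact/homog_mx_shift/dG.
have aF' : homog_mx (@shift _ _ F 0) (fun _ => 0) (aug F).
  by move=> k l; rewrite ord1 subr0.
(* The second clause is what makes the next lift possible. *)
pose P i (A : 'M[S]_(rank G i, rank F i)) :=
  homog_mx (fun k => shift k + a) (@shift K n F i) A /\
  exists W, diff G i *m A = W *m diff F i.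
have [phi0 phi0P] := exact_aug_surj (m *: aug G) exF.
pose phi0' := hcomp_mx (fun k => shift k + a) (@shift K n F 0) phi0.
(* As [I] is homogeneous, the congruence for [phi0] passes to its component of degree
   [shift k + a]. *)
have phi0'P k l : I ((m *: aug G - phi0' *m aug F) k l).
  have := homI (shift k + a) _ (phi0P k l); congr I.
  rewrite -(hcomp_mxM _ _ aF') !mxE raddfB /= subr0; congr (_ - _).
  by rewrite ord1 hcomp_id // addrC; apply: in_degreeM.
have Pphi0 : P 0 phi0'.
  split; first exact: homog_hcomp_mx.
  apply: (exact_aug_ker exF) => k l; rewrite -mulmxA.
  (* The first term is [m] times an element of [J], the second a combination of errors already in
     [I]. *)
  have -> : diff G 0 *m (phi0' *m aug F) =
      m *: (diff G 0 *m aug G) - diff G 0 *m (m *: aug G - phi0' *m aug F).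
    by rewrite mulmxBr -scalemxAr subKr.
  rewrite mxE [X in _ + X]mxE; apply: idealB => //; last exact: ideal_mulmx.
  by rewrite mxE mulrC; apply/JI/(exact_diff_aug exG).
have step i A : P i A -> exists2 B, P i.+1 B & diff G i *m A = B *m diff F i.
  move=> [hA exW].
  have [B dGA hB] := homog_factor (homog_mxM (dG' i) hA) (dF i) exW.
  exists B => //; split=> //; apply: (exact_ker exF).
  by rewrite -mulmxA -dGA mulmxA (exact_diffM _ exG) mul0mx.
have [phi [phi_0 Pphi phiS]] := dependent_choice Pphi0 step.
exists phi; split; [by move=> i; case: (Pphi i) | | exact: phiS].
by rewrite phi_0; exact: phi0'P.
Qed.
End Comparison.

(** * Reduction to constant terms and uniqueness of graded Betti numbers *)

Section BettiUniqueness.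
Variables (K : fieldType) (n : nat).
Local Notation S := {mpoly K[n]}.
Implicit Types (I : S -> Prop) (F G : graded_free_data K n).

(** Reduction modulo the ideal of the variables, that is, tensoring with K. *)
Definition ct_mx p q (A : 'M[S]_(p, q)) : 'M[K]_(p, q) := map_mx (mcoeff 0%MM) A.

Lemma ct_mxM p q r (A : 'M[S]_(p, q)) (B : 'M[S]_(q, r)) :
  ct_mx (A *m B) = ct_mx A *m ct_mx B.
Proof. exact: map_mxM. Qed.

(* A chain endomorphism inducing 0 on S / I is null-homotopic, say
   [theta = h d + d h], and [d] has no constant terms. *)
Lemma ct_null_homotopic I F (theta : forall i, 'M[S]_(rank F i)) :
  exact_over I F -> minimal F ->
  (forall k l, I ((theta 0 *m aug F) k l)) ->
  (forall i, diff F i *m theta i = theta i.+1 *m diff F i) ->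
  forall i, ct_mx (theta i) = 0.
Proof.
move=> exF minF aug0 thetaC.
have ct_d i : ct_mx (diff F i) = 0 by apply/matrixP=> k l; rewrite !mxE minF.
have ct_Md i p (h : 'M_(p, _)) : ct_mx (h *m diff F i) = 0.
  by rewrite ct_mxM ct_d mulmx0.
(* The induction carries the homotopy component [h] through the vanishing from which exactness
   produces the next component. *)
have H i : ct_mx (theta i) = 0 /\
    exists h, (theta i.+1 - diff F i *m h) *m diff F i = 0.
  elim: i => [|i [_ [h hP]]].
    have [h hP] := exact_aug_ker exF aug0.
    split; first by rewrite hP ct_Md.
    by exists h; rewrite mulmxBl -thetaC {1}hP mulmxA subrr.
  have [h' h'P] := exact_ker exF hP.
  have thetaE : theta i.+1 = h' *m diff F i.+1 + diff F i *m h.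
    by rewrite -h'P subrK.
  split.
    rewrite thetaE /ct_mx map_mxD -/(ct_mx _) ct_Md.
    by rewrite -/(ct_mx (_ *m h)) ct_mxM ct_d mul0mx addr0.
  exists h'; rewrite mulmxBl -thetaC -mulmxA -h'P mulmxBr opprB addrCA subrr addr0.
  by rewrite mulmxA (exact_diffM _ exF) mul0mx.
by move=> i; case: (H i).
Qed.

(** [A] vanishes between different degrees, so the blocks of degree [j] still multiply to the
    identity, which bounds the sizes. *)
Lemma card_le_graded_retract p q (a : 'I_p -> int) (b : 'I_q -> int)
    (A : 'M[K]_(p, q)) (B : 'M[K]_(q, p)) (j : int) :
  (forall k l, a k != b l -> A k l = 0) -> A *m B = 1%:M ->
  (#|[set k | a k == j]| <= #|[set l | b l == j]|)%N.
Proof.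
move=> Aab AB; set P := [set k | _]; set Q := [set l | _].
pose A' := \matrix_(i < #|P|, i' < #|Q|) A (enum_val i) (enum_val i').
pose B' := \matrix_(i' < #|Q|, i < #|P|) B (enum_val i') (enum_val i).
suff AB' : A' *m B' = 1%:M by apply: mulmx1_min AB'.
apply/matrixP=> i1 i2; rewrite !mxE.
have := congr1 (fun C : 'M_p => C (enum_val i1) (enum_val i2)) AB.
rewrite !mxE (inj_eq enum_val_inj) => <-.
rewrite (bigID (mem Q)) /= [X in _ = _ + X]big1 ?addr0 => [|l lQ]; last first.
  rewrite Aab ?mul0r //; have := enum_valP i1; rewrite inE => /eqP->.
  by rewrite inE eq_sym in lQ.
by rewrite [RHS]big_enum_val; apply: eq_bigr => l _; rewrite !mxE.
Qed.

(** With chain maps [phi] and [psi] lifting the identity in both directions, [phi i *m psi i] is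
    homotopic to the identity, hence equal to it on constant terms. *)
Lemma num_shifts_le I F G :
  is_ideal I -> homogeneous_ideal I ->
  minimal_graded_free_resolution I F -> minimal_graded_free_resolution I G ->
  forall i j, (num_shifts F i j <= num_shifts G i j)%N.
Proof.
move=> idI homI [grF exF minF] [grG exG _] i j.
have I1 f : I f -> I (f * 1) by rewrite mulr1.
have [phi [hphi phi0 phiC]] :=
  comparison idI homI (@in_degree1 K n) I1 grG exG grF exF.
have [psi [_ psi0 psiC]] :=
  comparison idI homI (@in_degree1 K n) I1 grF exF grG exG.
have ct1 : ct_mx (phi i *m psi i - 1%:M) = 0.
  apply: (ct_null_homotopic (theta := fun i => phi i *m psi i - 1%:M) exF minF).
  - move=> k l.
    have -> : (phi 0 *m psi 0 - 1%:M) *m aug F =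
       - (phi 0 *m (1 *: aug G - psi 0 *m aug F)) - (1 *: aug F - phi 0 *m aug G).
      by rewrite !scale1r mulmxBl mul1mx mulmxBr !opprB -mulmxA addrA subrK.
    rewrite mxE [X in _ + X]mxE [X in X + _]mxE.
    by apply: idealB => //; apply: idealN => //; apply: ideal_mulmx.
  - move=> {}i; rewrite mulmxBr mulmxBl mulmx1 mul1mx mulmxA phiC -mulmxA psiC.
    by rewrite mulmxA.
apply: (card_le_graded_retract (A := ct_mx (phi i)) (B := ct_mx (psi i))).
  (* An entry between different shifts has nonzero degree, hence no constant term. *)
  move=> k l ne; rewrite mxE (mcoeff0_in_degree _ (hphi i k l)) //.
  by rewrite addr0 subr_eq0.
apply/eqP; rewrite -ct_mxM -subr_eq0 -{}ct1 /ct_mx map_mxB; apply/eqP.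
by congr (_ - _); rewrite map_mx1.
Qed.

Lemma graded_betti_num_shifts I F :
  is_ideal I -> homogeneous_ideal I -> minimal_graded_free_resolution I F ->
  graded_betti I (num_shifts F).
Proof.
move=> idI homI resF; split=> [|G resG i j]; first by exists F.
by apply/eqP; rewrite eqn_leq !(num_shifts_le idI homI).
Qed.

End BettiUniqueness.

(** * Mapping cones and linear resolutions *)

Section MappingCone.
Variables (K : fieldType) (n : nat).
Local Notation S := {mpoly K[n]}.
Implicit Types (I J : S -> Prop) (F G : graded_free_data K n).

Section Construction.
Variables (F G : graded_free_data K n) (a : int).
Variable phi : forall i, 'M[S]_(rank G i, rank F i).

(** The i-th term is F_i + G_(i-1)(-a), with differential (u, w) -> (u d + w phi, - w d); term 0 is
    just F_0. *)
Definition cone_rank i := if i is i'.+1 then (rank F i + rank G i')%N else rank F 0.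

Definition cone_shift i : 'I_(cone_rank i) -> int :=
  match i return 'I_(cone_rank i) -> int with
  | 0 => @shift _ _ F 0
  | i'.+1 => fun k => match split k with inl k => shift k | inr k => shift k + a end
  end.

Definition cone_diff i : 'M[S]_(cone_rank i.+1, cone_rank i) :=
  match i return 'M[S]_(cone_rank i.+1, cone_rank i) with
  | 0 => col_mx (diff F 0) (phi 0)
  | i'.+1 => block_mx (diff F i'.+1) 0 (phi i'.+1) (- diff G i')
  end.

Definition cone := GradedFreeData cone_shift cone_diff (aug F).

Lemma graded_maps_cone :
  (forall i, homog_mx (fun k => shift k + a) (@shift _ _ F i) (phi i)) ->
  graded_maps F -> graded_maps G -> graded_maps cone.
Proof.
move=> hphi [dF aF] [dG aG]; split=> // -[|i] k l /=.
  by rewrite !mxE; case: splitP => k' _; [exact: dF | exact: hphi].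
rewrite !mxE; case: splitP => k' _; rewrite !mxE; case: splitP => l' _ //.
- by rewrite mxE; apply: in_degree0.
- exact: hphi.
- by rewrite mxE opprD addrACA subrr addr0; apply/in_degreeN/dG.
Qed.

(** The cone resolves S/(I + (m)) because multiplication by [m] embeds S/(I : m) in S/I with this
    quotient. The proof is the diagram chase on elements. *)
Lemma exact_cone I J (m : S) :
  is_ideal I -> (forall f, J f <-> colon I m f) ->
  lifts_mul I m a phi -> exact_over I F -> exact_over J G ->
  exact_over (fun f => exists c, I (f - c * m)) cone.
Proof.
move=> idI JE [_ phi0 phiC] exF exG; have [surjF kerF _] := exF.
have phi0_aug p (w : 'M_(p, _)) k l :
    I (m * (w *m aug G) k l - (w *m phi 0 *m aug F) k l).
  have := ideal_mulmx w idI phi0 k l.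
  by rewrite mulmxBr -scalemxAr mulmxA !mxE.
have dphi i : diff G i *m phi i = phi i.+1 *m diff F i by [].
split.
- move=> f; have [v Iv] := surjF f; exists v; exists 0.
  by rewrite mul0r subr0.
- move=> v; split=> [[c Ic]|[w ->]].
    (* [w] lifts the class of [c] in S/J, so [w *m phi 0] accounts for [c * m] modulo [I], and
       [v - w *m phi 0] is sent into [I]. *)
    have [surjG _ _] := exG; have [w wP] := surjG c.
    have /kerF[u uE] : I (((v - w *m phi 0) *m aug F) 0 0).
      have -> : ((v - w *m phi 0) *m aug F) 0 0 =
          ((v *m aug F) 0 0 - c * m) + (c - (w *m aug G) 0 0) * m
          + (m * (w *m aug G) 0 0 - (w *m phi 0 *m aug F) 0 0).
        rewrite mulmxBl [LHS]mxE [X in _ + X]mxE mulrBl [m * _]mulrC.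
        by rewrite !addrA !subrK.
      by apply: idealD => //; apply: idealD => //; apply/JE.
    exists (row_mx u w); rewrite /= mul_row_col -uE subrK //.
  rewrite /= -[w]hsubmxK mul_row_col; set u := lsubmx w; set y := rsubmx w.
  exists ((y *m aug G) 0 0).
  rewrite mulmxDl [(_ + _ : 'M_(1, 1)) 0 0]mxE -addrA; apply: idealD => //.
    by apply/kerF; exists u.
  by rewrite -opprB mulrC; apply: idealN.
- move=> i v; split=> [v0|[w ->]]; last first.
    case: i v w {kerF} => [|i] v w /=; rewrite -[w]hsubmxK.
      rewrite mul_row_block mul_row_col mulmx0 add0r mulmxDl -!mulmxA.
      rewrite (exact_diffM _ exF) mulmx0 add0r.
      by rewrite -dphi mulNmx mulmxN subrr.
    rewrite !mul_row_block !mulmx0 !add0r mulmxDl -!mulmxA (exact_diffM _ exF) mulmx0 add0r.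
    rewrite -dphi !mulNmx !mulmxN subrr opprK.
    by rewrite (exact_diffM _ exG) mulmx0 row_mx0.
  have [u [w [vE uw0]]] : exists (u : 'rV_(rank F i.+1)) (w : 'rV_(rank G i)),
      v = row_mx u w /\ u *m diff F i + w *m phi i = 0.
    exists (lsubmx v), (rsubmx v); rewrite hsubmxK; split=> //.
    case: i v v0 => [|i] v; rewrite -{1}[v]hsubmxK /=.
      by rewrite mul_row_col.
    by rewrite mul_row_block => /(congr1 lsubmx); rewrite row_mxKl linear0.
  (* [w] is a cycle of [G]; in degree 0 this means that its augmentation lies in [J], read off from
     [m] times it lying in [I]. The sign matches that of [diff G] in the cone. *)
  have [y yE] : exists y, w = - y *m diff G i.
    suff [y ->] : exists y, w = y *m diff G i by exists (- y); rewrite opprK.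
    case: i v v0 u w vE uw0 => [|i] v v0 u w vE uw0.
      apply: (exact_aug_ker exG) => k l; rewrite ord1 {k}.
      apply/JE; rewrite /colon mulrC ord1.
      apply/(ideal_congr idI (phi0_aug _ w 0 0)).
      move/eqP: uw0; rewrite addrC addr_eq0 => /eqP->.
      by rewrite -mulNmx; apply/kerF; exists (- u).
    apply: (exact_ker exG); move: v0; rewrite vE /= mul_row_block.
    move=> /(congr1 rsubmx); rewrite row_mxKr mulmx0 add0r mulmxN linear0.
    by move=> /eqP; rewrite oppr_eq0 => /eqP.
  have [x xE] : exists x, u - y *m phi i.+1 = x *m diff F i.+1.
    apply: (exact_ker exF); rewrite mulmxBl -mulmxA -dphi mulmxA.
    by rewrite -uw0 yE !mulNmx.
  exists (row_mx x y); rewrite vE /= mul_row_block mulmx0 add0r.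
  by rewrite -xE subrK yE mulmxN mulNmx.
Qed.

End Construction.

(** For i >= 1 the i-th term is generated in degree i + a - 1; hence the offset between [i.+1] and
    [i + a]. *)
Definition linear_resolution (a : nat) I F :=
  [/\ graded_maps F, exact_over I F, forall k : 'I_(rank F 0), shift k = 0
    & forall i (k : 'I_(rank F i.+1)), shift k = (i + a)%N].

(** The i-th term of [G] sits in degree i; twisted by [a] and moved to homological degree i + 1, it
    has the degree required there. *)
Lemma linear_resolution_cone (a : nat) I J (m : S) F G :
  is_ideal I -> homogeneous_ideal I -> in_degree a m ->
  (forall f, J f <-> colon I m f) ->
  linear_resolution a I F -> linear_resolution 1 J G ->
  exists H, linear_resolution a (fun f => exists c, I (f - c * m)) H.
Proof.
move=> idI homI ma JE [grF exF F0 FS] [grG exG G0 GS].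
have JI f : J f -> I (f * m) by move/JE.
have [phi phiP] := comparison idI homI ma JI grF exF grG exG.
exists (cone a phi); split=> //.
- by have [hphi _ _] := phiP; apply: graded_maps_cone.
- exact: exact_cone phiP exF exG.
- move=> i k /=; case: splitP => k' _; first exact: FS.
  by case: i k k' => [|i] k k'; rewrite ?G0 ?GS // addn1.
Qed.

(** Entries of the differentials have degree [a] at the first step and 1 afterwards, both
    positive. *)
Lemma linear_resolution_minimal (a : nat) I F :
  (0 < a)%N -> linear_resolution a I F -> minimal_graded_free_resolution I F.
Proof.
move=> a0 [grF exF F0 FS]; split=> // i k l; case: (grF) => /(_ i k l) + _.
apply: mcoeff0_in_degree; rewrite FS subr_eq0.
case: i k l => [|i] k l; first by rewrite F0 add0n; case: a a0 {FS}.
by rewrite FS eqz_nat addSn gtn_eqF.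
Qed.

Lemma exact_over_ext I J F : (forall f, I f <-> J f) -> exact_over I F -> exact_over J F.
Proof.
move=> IJ [surjF kerF exF]; split=> // [f|v]; last by rewrite -kerF IJ.
by have [v /IJ Jv] := surjF f; exists v.
Qed.

Lemma linear_resolution_ext a I J F : (forall f, I f <-> J f) ->
  linear_resolution a I F -> linear_resolution a J F.
Proof. by move=> IJ [? /(exact_over_ext IJ)]. Qed.

Lemma linear_resolution0 a : exists F, linear_resolution a (fun f => f = 0) F.
Proof.
pose r i := (i == 0)%N : nat.
exists (@GradedFreeData K n r (fun i _ => 0) (fun i => 0) 1); split=> //=.
- split=> [i k l|k]; first by rewrite mxE; apply: in_degree0.
  by rewrite ord1 mxE; apply: in_degree1.
- split=> [f|v|i v] /=.
  + by exists f%:M; rewrite mulmx1 mxE mulr1n subrr.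
  + rewrite mulmx1; split=> [v0|[w ->]]; last by rewrite mulmx0 mxE.
    exists 0; rewrite mul0mx; apply/matrixP=> k l.
    by rewrite [k]ord1 [l]ord1 v0 mxE.
  + split=> [_|_]; last by rewrite mulmx0.
    by exists 0; apply/matrixP => k [].
- by move=> i [].
Qed.

(** If F_1 were 0, the augmentation would embed F_0 in S/I. A lift [v] of 1 would then satisfy f v =
    0, so v = 0 and 1 would lie in [I]. *)
Lemma rank1_gt0 I F f : is_ideal I -> exact_over I F ->
  f != 0 -> I f -> ~ I 1 -> (0 < rank F 1)%N.
Proof.
move=> idI [surjF kerF _] f0 If I1; rewrite lt0n; apply: contra_notN I1 => /eqP r0.
have I_eq0 (v : 'rV_(rank F 0)) : I ((v *m aug F) 0 0) -> v = 0.
  move=> /kerF[w ->]; apply/matrixP=> k l; rewrite !mxE big1 // => i.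
  by have := ltn_ord i; rewrite {2}r0.
have [v Iv] := surjF 1; suff v0 : v = 0.
  by move: Iv; rewrite v0 mul0mx mxE subr0.
have : f *: v = 0.
  apply: I_eq0; rewrite -scalemxAl mxE.
  have := idealB idI If (idealMl f idI Iv).
  by rewrite mulrBr mulr1 subKr.
by move=> /eqP; rewrite scalemx_eq0 (negPf f0) => /eqP.
Qed.

Lemma linear_resolution_regularity (a : nat) I F :
  (0 < a)%N -> is_ideal I -> homogeneous_ideal I -> linear_resolution a I F ->
  (0 < rank F 1)%N -> is_regularity I (a%:Z - 1).
Proof.
move=> a0 idI homI linF r0; have [_ _ F0 FS] := linF.
exists (num_shifts F).
  exact/graded_betti_num_shifts/(linear_resolution_minimal a0).
split.
  (* The first term, nonzero and generated in degree [a], attains the bound. *)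
  exists 1%N, a; split=> //; apply/eqP; rewrite -lt0n; apply/card_gt0P.
  by exists (Ordinal r0); rewrite inE FS.
move=> i j /eqP; rewrite -lt0n => /card_gt0P[k]; rewrite inE => /eqP <-.
case: i k => [|i] k; first by rewrite F0 subr0 subr_ge0; case: a a0 {linF FS}.
by rewrite FS -addn1 !PoszD opprD addrACA subrr add0r.
Qed.

End MappingCone.

(** * Ideals with linear quotients *)

Section GeneratedIdeals.
Variable R : comNzRingType.
Implicit Types (I gens : R -> Prop) (f g : R).

Lemma ideal_gen_ideal gens : is_ideal (ideal_gen gens).
Proof.
split=> [|a f g [p [c [x [genx ->]]]] [q [d [y [geny ->]]]]].
  by exists 0, (fun _ => 0), (fun _ => 0); split=> [[]|] //; rewrite big_ord0.
exists (p + q)%N, (fun k => match split k with inl k => a * c k | inr k => d k end),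
  (fun k => match split k with inl k => x k | inr k => y k end).
split=> [k|]; first by case: splitP.
rewrite big_split_ord mulr_sumr; congr (_ + _); apply: eq_bigr => k _.
  by rewrite (unsplitK (inl k)) mulrA.
by rewrite (unsplitK (inr k)).
Qed.

Lemma ideal_gen_mem gens t : gens t -> ideal_gen gens t.
Proof.
move=> gent; exists 1, (fun _ => 1), (fun _ => t); split=> //.
by rewrite big_ord1 mul1r.
Qed.

Lemma ideal_gen_min gens I : is_ideal I -> (forall t, gens t -> I t) ->
  forall f, ideal_gen gens f -> I f.
Proof.
move=> idI genI f [p [c [x [genx ->]]]]; apply: ideal_sum => // k.
by apply: idealMl => //; apply: genI.
Qed.

Lemma ideal_gen_ext gens gens' : (forall t, gens t <-> gens' t) ->
  forall f, ideal_gen gens f <-> ideal_gen gens' f.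
Proof.
by move=> E f; split; apply: ideal_gen_min => [|t /E]; try exact: ideal_gen_ideal;
  exact: ideal_gen_mem.
Qed.

Lemma is_ideal_adjoin I m : is_ideal I -> is_ideal (fun f => exists c, I (f - c * m)).
Proof.
move=> idI; split=> [|a f g [c Ic] [d Id]].
  by exists 0; rewrite mul0r subr0; apply: ideal0.
exists (a * c + d); rewrite mulrDl -mulrA opprD addrACA -mulrBr; exact: idealMD.
Qed.

Lemma is_ideal_colon I m : is_ideal I -> is_ideal (colon I m).
Proof.
move=> idI; split=> [|a f g]; rewrite /colon; first by rewrite mul0r; apply: ideal0.
by rewrite mulrDl -mulrA; apply: idealMD.
Qed.

Definition seq_ideal (s : seq R) := ideal_gen (fun t => t \in s).

Lemma seq_ideal_ideal s : is_ideal (seq_ideal s).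
Proof. exact: ideal_gen_ideal. Qed.

Lemma seq_ideal_nil f : seq_ideal [::] f <-> f = 0.
Proof.
split=> [|->]; last exact: (ideal0 (seq_ideal_ideal _)).
apply: (ideal_gen_min (I := fun g => g = 0)) => [|t]; last by rewrite in_nil.
by split=> // a g h -> ->; rewrite mulr0 addr0.
Qed.

(** Puts the ideal in the form resolved by a mapping cone. *)
Lemma seq_ideal_cons m s f :
  seq_ideal (m :: s) f <-> exists c, seq_ideal s (f - c * m).
Proof.
split=> [|[c Ic]].
  apply: (ideal_gen_min (I := fun g => exists c, seq_ideal s (g - c * m))) => [|t].
    exact: (is_ideal_adjoin m (seq_ideal_ideal s)).
  rewrite inE => /predU1P[->|ts].
    by exists 1; rewrite mul1r subrr; apply: (ideal0 (seq_ideal_ideal _)).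
  by exists 0; rewrite mul0r subr0; apply: ideal_gen_mem.
rewrite -[f](subrK (c * m)); apply: idealD; first exact: seq_ideal_ideal.
  apply: ideal_gen_min Ic => [|t ts]; first exact: seq_ideal_ideal.
  by apply: ideal_gen_mem; rewrite inE ts orbT.
apply: idealMl; first exact: seq_ideal_ideal.
by apply: ideal_gen_mem; rewrite inE eqxx.
Qed.

End GeneratedIdeals.

(** * Squarefree monomials, ideals of variables and linear quotients *)

Section MonomialIdeals.
Variables (K : fieldType) (n : nat).
Local Notation S := {mpoly K[n]}.
Implicit Types (I : S -> Prop) (A : {pred 'I_n}) (C D : {set 'I_n}) (f g : S).

Lemma homogeneous_ideal_gen (gens : S -> Prop) :
  (forall t, gens t -> exists j, in_degree j t) -> homogeneous_ideal (ideal_gen gens).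
Proof.
move=> homg j f [p [c [x [genx ->]]]]; have idI := ideal_gen_ideal gens.
rewrite raddf_sum; apply: ideal_sum => // k /=.
have [i xi] := homg _ (genx k).
by rewrite (hcompM _ _ xi); apply: idealMl => //; apply: ideal_gen_mem.
Qed.

(* Setting the variables of A to 0: a ring morphism whose kernel is the ideal
   generated by these variables. *)
Definition kill A : S -> S :=
  comp_mpoly [tuple (if i \in A then 0 else 'X_i) | i < n].

Lemma kill0 A : kill A 0 = 0.
Proof. exact: rmorph0. Qed.

Lemma kill1 A : kill A 1 = 1.
Proof. exact: rmorph1. Qed.

Lemma killD A : {morph kill A : f g / f + g}.
Proof. exact: rmorphD. Qed.

Lemma killM A : {morph kill A : f g / f * g}.
Proof. exact: rmorphM. Qed.

Lemma killZ A c : {morph kill A : f / c *: f}.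
Proof. by move=> f; rewrite /kill comp_mpolyZ. Qed.

Lemma killX A i : kill A 'X_i = if i \in A then 0 else 'X_i.
Proof. by rewrite /kill comp_mpolyXU -tnth_nth tnth_mktuple. Qed.

(** The polynomials satisfying the congruence include 1 and the variables and are closed under
    products and linear combinations. *)
Lemma kill_congr I A : is_ideal I -> (forall i, i \in A -> I 'X_i) ->
  forall f, I (f - kill A f).
Proof.
move=> idI IA.
pose P f := I (f - kill A f).
have PM f g : P f -> P g -> P (f * g).
  move=> Pf Pg; rewrite /P killM.
  have -> : f * g - kill A f * kill A g = f * (g - kill A g) + kill A g * (f - kill A f).
    by rewrite !mulrBr addrA [kill A g * f]mulrC [kill A g * _]mulrC subrK.
  exact: (idealMD _ idI Pg (idealMl _ idI Pf)).
have P1 : P 1 by rewrite /P kill1 subrr; apply: ideal0.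
have PX i : P 'X_i.
  rewrite /P killX; case: ifP => iA; first by rewrite subr0; apply: IA.
  by rewrite subrr; apply: ideal0.
elim/mpolyind => [|c m f _ _ If]; first by rewrite kill0 subrr; apply: ideal0.
rewrite killD killZ opprD addrACA -scalerBr -mul_mpolyC.
apply: (idealMD _ idI _ If); rewrite -/(P _) mpolyXE_id.
apply: (big_ind P P1 PM) => i _; elim: (m i) => [|k IHk]; first exact: P1.
by rewrite exprS; exact: (PM _ _ (PX i) IHk).
Qed.

Lemma seq_ideal_variables (L : seq 'I_n) f :
  seq_ideal [seq 'X_i | i <- L] f <-> kill (mem L) f = 0.
Proof.
have idI := seq_ideal_ideal [seq 'X_i : S | i <- L].
split.
  apply: (ideal_gen_min (I := fun g => kill (mem L) g = 0)) => [|t /mapP[i iL ->]];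
    last by rewrite killX iL.
  split=> [|a g h]; first by rewrite kill0.
  by rewrite killD killM => -> ->; rewrite mulr0 addr0.
move=> f0; rewrite -[f]subr0 -f0; apply: kill_congr => // i iL.
by apply: ideal_gen_mem; apply: map_f.
Qed.

Definition sqfree C : S := \prod_(i in C) 'X_i.

Lemma sqfree_setU1 i C : i \notin C -> sqfree (i |: C) = 'X_i * sqfree C.
Proof. by move=> iC; rewrite /sqfree big_setU1. Qed.

Lemma mpolyX_neq0 (m : 'X_{1..n}) : 'X_[m] != 0 :> S.
Proof. by rewrite -msupp_eq0 msuppX. Qed.

Lemma sqfree_neq0 C : sqfree C != 0.
Proof. by apply/prodf_neq0 => i _; apply: mpolyX_neq0. Qed.

Lemma sqfree_subset C D : C \subset D -> exists g, sqfree D = g * sqfree C.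
Proof.
move=> CD; exists (sqfree (D :\: C)).
rewrite /sqfree (big_setID C) /= mulrC; congr (_ * _).
by move/setIidPr: CD ->.
Qed.

Lemma in_degree_sqfree C : in_degree #|C| (sqfree C).
Proof.
rewrite /sqfree -sum1_card; elim/big_rec2: _ => [|i d f _]; first exact: in_degree1.
by apply: dhomogM; rewrite dhomogX /= mdeg1.
Qed.

Lemma kill_sqfree A C : (kill A (sqfree C) == 0) = [exists i in C, i \in A].
Proof.
rewrite /sqfree (big_morph _ (killM A) (kill1 A)) prodf_seq_eq0 /=.
apply/hasP/existsP => [[i _]|[i]].
  rewrite killX; case: ifP => iA; rewrite ?(negPf (mpolyX_neq0 _)) ?andbF //.
  by case/andP=> iC _; exists i; rewrite iC iA.
by case/andP=> iC iA; exists i; rewrite ?mem_index_enum //= iC killX iA eqxx.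
Qed.

(** The Koszul complex as an iterated cone: a variable outside [L] is a nonzerodivisor modulo the
    ideal of [L], so taking the colon by it changes nothing. *)
Lemma variables_resolution (L : seq 'I_n) : uniq L ->
  exists F, linear_resolution 1 (seq_ideal [seq 'X_i : S | i <- L]) F.
Proof.
elim: L => [_|i L IHL /= /andP[iL uL]].
  have [F linF] := linear_resolution0 K n 1; exists F.
  by apply: linear_resolution_ext linF => f; rewrite seq_ideal_nil.
have [F linF] := IHL uL.
have XiL f : seq_ideal [seq 'X_i | i <- L] f <-> colon (seq_ideal [seq 'X_i | i <- L]) 'X_i f.
  rewrite /colon !seq_ideal_variables killM killX (negPf iL).
  split=> [->|/eqP]; first by rewrite mul0r.
  by rewrite mulf_eq0 (negPf (mpolyX_neq0 _)) orbF => /eqP.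
have homL : homogeneous_ideal (seq_ideal [seq 'X_i : S | i <- L]).
  apply: homogeneous_ideal_gen => t /mapP[j _ ->].
  by exists 1; rewrite /= dhomogX /= mdeg1.
have X1 : in_degree 1%N ('X_i : S) by rewrite /= dhomogX /= mdeg1.
have [H linH] := linear_resolution_cone (seq_ideal_ideal _) homL X1 XiL linF linF.
by exists H; apply: linear_resolution_ext linH => f; rewrite seq_ideal_cons.
Qed.

(* The generators are added from the last one of the list to its head. *)
Fixpoint linear_quotients (s : seq S) : Prop :=
  if s is m :: s' then
    (exists2 L : seq 'I_n, uniq L &
       forall f, seq_ideal [seq 'X_i | i <- L] f <-> colon (seq_ideal s') m f) /\
    linear_quotients s'
  else True.

Lemma linear_quotients_resolution (a : nat) (s : seq S) :
  {in s, forall t, in_degree a t} -> linear_quotients s ->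
  exists F, linear_resolution a (seq_ideal s) F.
Proof.
elim: s => [_ _|m s IHs homs [[L uL colonL] lq]].
  have [F linF] := linear_resolution0 K n a; exists F.
  by apply: linear_resolution_ext linF => f; rewrite seq_ideal_nil.
have homs' : {in s, forall t, in_degree a t}.
  by move=> t ts; apply: homs; rewrite inE ts orbT.
have [F linF] := IHs homs' lq; have [G linG] := variables_resolution uL.
have homI : homogeneous_ideal (seq_ideal s).
  by apply: homogeneous_ideal_gen => t ts; exists a; apply: homs'.
have ma : in_degree a m by apply: homs; rewrite inE eqxx.
have [H linH] := linear_resolution_cone (seq_ideal_ideal _) homI ma colonL linF linG.
by exists H; apply: linear_resolution_ext linH => f; rewrite seq_ideal_cons.
Qed.

(** For [v] in [L], some generator divides ['X_v * sqfree C]. Conversely, setting the variables of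
    [L] to 0 kills all generators but not [sqfree C], and the ring is a domain. *)
Lemma colon_sqfree (Ds : seq {set 'I_n}) C (L : seq 'I_n) :
  {in L, forall v, v \notin C /\ exists2 D, D \in Ds & D \subset v |: C} ->
  {in Ds, forall D : {set 'I_n}, exists2 v, v \in L & v \in D} ->
  forall f, seq_ideal [seq 'X_i | i <- L] f <->
            colon (seq_ideal [seq sqfree D | D <- Ds]) (sqfree C) f.
Proof.
move=> LP DsP f; split.
  apply: (ideal_gen_min (I := colon _ (sqfree C))) => [|t /mapP[v /LP[vC [D DDs sDC]] ->]].
    exact/is_ideal_colon/seq_ideal_ideal.
  rewrite /colon -sqfree_setU1 //; have [g ->] := sqfree_subset sDC.
  apply: idealMl; first exact: seq_ideal_ideal.
  by apply: ideal_gen_mem; apply: map_f.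
move=> Ifm; apply/seq_ideal_variables/eqP.
have : kill (mem L) (f * sqfree C) = 0.
  apply: (ideal_gen_min (I := fun g => kill (mem L) g = 0)) Ifm => [|t /mapP[D /DsP[v vL vD] ->]].
    split=> [|a g h]; first by rewrite kill0.
    by rewrite killD killM => -> ->; rewrite mulr0 addr0.
  by apply/eqP; rewrite kill_sqfree; apply/existsP; exists v; rewrite vD.
move/eqP; rewrite killM mulf_eq0 kill_sqfree => /orP[] // /existsP[v /andP[vC vL]].
by have [] := LP v vL; rewrite vC.
Qed.

End MonomialIdeals.

(** * Covers, facets and the cover ideal *)

Section Covers.
Variables (V : finType) (e : rel V).
Implicit Types (A C F : {set V}).
Local Notation D := (independence_complex e).

Lemma stableP A : reflect {in A &, forall x y, ~~ e x y} (stable e A).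
Proof.
by apply: (iffP 'forall_in_forall_inP) => H x; [move=> y xA yA | move=> xA y yA]; exact: H.
Qed.

Lemma vertex_coverP C : reflect (forall x y, e x y -> (x \in C) || (y \in C)) (vertex_cover e C).
Proof. by apply: (iffP 'forall_'forall_implyP). Qed.

Lemma vertex_coverC A : vertex_cover e (~: A) = stable e A.
Proof.
apply/vertex_coverP/stableP => [H x y xA yA|H x y exy].
  by apply/negP => /H; rewrite !inE xA yA.
by rewrite !inE -negb_and; apply/negP => /andP[xA yA]; rewrite (negPf (H x y xA yA)) in exy.
Qed.

Lemma facetsP F : reflect (stable e F /\ forall A, stable e A -> F \subset A -> A = F)
  (F \in facets D).
Proof.
rewrite in_set; apply: (iffP maxsetP); rewrite /= in_set => -[sF maxF]; split=> // A.
  by move=> sA; apply: maxF; rewrite inE.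
by rewrite inE; apply: maxF.
Qed.

Lemma min_vertex_coverC F : min_vertex_cover e (~: F) = (F \in facets D).
Proof.
apply/minsetP/facetsP; rewrite vertex_coverC => -[sF minF]; split=> // A.
  by rewrite -vertex_coverC -setCS => sA /(minF _ sA)/setC_inj.
by rewrite -[A]setCK vertex_coverC setCS => sA /(minF _ sA)->.
Qed.

(** A smallest cover is minimal, so it is the complement of a facet, and all facets have equal
    size. *)
Lemma card_min_vertex_cover F : pure D -> F \in facets D -> #|~: F| = alpha0 e.
Proof.
move=> pureD FD; rewrite /alpha0; case: arg_minnP => [|C vC minC].
  by apply/vertex_coverP => x y; rewrite inE.
have CD : ~: C \in facets D.
  rewrite -min_vertex_coverC setCK; apply/minsetP; split=> // B vB sBC.
  by apply/eqP; rewrite eqEcard sBC minC.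
by rewrite [LHS]cardsCs [RHS]cardsCs setCK (pureD _ _ FD CD).
Qed.

Lemma facet_exists (x : V) : irreflexive e -> exists2 F, F \in facets D & x \in F.
Proof.
move=> e_irr; have sx : (mem D) [set x].
  rewrite /= inE; apply/stableP => y z; rewrite !inE => /eqP-> /eqP->.
  by rewrite e_irr.
have [F maxF sxF] := maxset_exists sx; exists F; first by rewrite inE.
by rewrite -sub1set.
Qed.

(** The first two facets of a shelling; there are two because the ends of an edge lie in different
    facets. *)
Lemma adjacent_facets : symmetric e -> irreflexive e -> (exists x y, e x y) ->
  pure D -> shellable D ->
  exists F H u v, [/\ F \in facets D, H \in facets D, F :\: H = [set u],
                      H :\: F = [set v] & e u v].
Proof.
move=> e_sym e_irr [x [y exy]] pureD [Fs [uFs FsE shFs]].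
have [Fx FxD xFx] := facet_exists x e_irr.
have [Fy FyD yFy] := facet_exists y e_irr.
have neF : Fx != Fy.
  apply: contraTneq exy => FxE; move/facetsP: FxD => [/stableP sFx _].
  by apply: sFx => //; rewrite FxE.
have size_Fs : (1 < size Fs)%N.
  move: FxD FyD; rewrite -!FsE; case: Fs {uFs FsE shFs} => [|F [|H s]] //=.
  by rewrite !inE => /eqP xE /eqP yE; rewrite xE yE eqxx in neF.
have nthD i : (i < size Fs)%N -> nth set0 Fs i \in facets D.
  by move=> ltiFs; rewrite -FsE mem_nth.
(* For the second facet, l < 1 leaves only the first one to compare with. *)
have [v _ [[|l] // _ HF]] := shFs 0 1 size_Fs.
set F := nth set0 Fs 0 in HF; set H := nth set0 Fs 1 in HF.
have [FD HD] : F \in facets D /\ H \in facets D by split; apply: nthD; rewrite // ltnW.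
have /eqP/cards1P[u FH] : #|F :\: H| = 1%N.
  have := cardsID H F; rewrite (pureD _ _ FD HD) -(cardsID F H) HF cards1 setIC.
  by move/addnI.
exists F, H, u, v; split=> //.
have [/stableP sF maxF] := facetsP _ FD; have [/stableP sH _] := facetsP _ HD.
(* If [u] and [v] were not adjacent, adding [v] to [F] would give a larger stable set. *)
apply/negPn/negP => neuv.
have vHF : v \in H :\: F by rewrite HF set11.
move: vHF; rewrite inE => /andP[vF vH].
have nev z : z \in F -> ~~ e v z.
  move=> zF; have [zH|zH] := boolP (z \in H); first exact: sH.
  have : z \in F :\: H by rewrite inE zH.
  by rewrite FH inE => /eqP->; rewrite e_sym.
have : v |: F = F.
  apply: maxF; last exact: subsetUr.
  apply/stableP => z t; rewrite !inE => /predU1P[->|zF] /predU1P[->|tF].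
  - by rewrite e_irr.
  - exact: nev.
  - by rewrite e_sym nev.
  - exact: sF.
by move/setP/(_ v); rewrite !inE eqxx (negPf vF).
Qed.

End Covers.

(** * The ideal of covers: degrees, v-number and linear resolution *)

Section CoverIdeal.
Variables (K : fieldType) (s : nat) (e : rel 'I_s).
Local Notation S := {mpoly K[s]}.
Local Notation D := (independence_complex e).
Local Notation I := (@cover_ideal K s e).
Local Notation a := (alpha0 e).

Lemma cover_ideal_ideal : is_ideal I.
Proof. exact: ideal_gen_ideal. Qed.

Lemma cover_ideal_facet F : F \in facets D -> I (sqfree K (~: F)).
Proof. by rewrite -min_vertex_coverC => cF; apply: ideal_gen_mem; exists (~: F). Qed.

Lemma cover_ideal_min (J : S -> Prop) : is_ideal J ->
  (forall F, F \in facets D -> J (sqfree K (~: F))) -> forall f, I f -> J f.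
Proof.
move=> idJ FJ; apply: ideal_gen_min => // t [C minC ->].
by rewrite -[C]setCK; apply: FJ; rewrite -min_vertex_coverC setCK.
Qed.

Lemma homogeneous_cover_ideal : homogeneous_ideal I.
Proof.
apply: homogeneous_ideal_gen => t [C _ ->]; exists #|C|; exact: in_degree_sqfree.
Qed.

Lemma cover_ideal_degree (d : nat) f :
  pure D -> I f -> in_degree d f -> f != 0 -> (a <= d)%N.
Proof.
move=> pureD [p [c [x [genx ->]]]] fd; apply: contraR; rewrite -ltnNge => ltda.
rewrite -(hcomp_id fd) raddf_sum big1 // => k _ /=.
have xa : in_degree a (x k).
  have [C minC ->] := genx k; rewrite -[C]setCK.
  rewrite -(card_min_vertex_cover (F := ~: C) pureD); last by rewrite -min_vertex_coverC setCK.
  exact: in_degree_sqfree.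
rewrite -/(hcomp d (c k * x k)) (hcompM _ _ xa).
(* The cofactor of a generator would need negative degree. *)
suff -> : hcomp (d%:Z - a%:Z) (c k) = 0 by rewrite mul0r.
have : d%:Z - a%:Z < 0 by rewrite subr_lt0.
by case: (d%:Z - a%:Z).
Qed.

Lemma alpha0_gt0 : (exists x y, e x y) -> (0 < a)%N.
Proof.
move=> [x [y exy]]; rewrite /alpha0; case: arg_minnP => [|C /vertex_coverP vC _].
  by apply/vertex_coverP => *; rewrite inE.
by apply/card_gt0P; case/orP: (vC x y exy); [exists x | exists y].
Qed.

Lemma v_witness_le d : pure D -> irreflexive e -> (exists x y, e x y) ->
  v_witness I d -> (a - 1 <= d)%N.
Proof.
move=> pureD e_irr [x _] [f fd [p [[[_ p1 _] primep] _] pE]].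
have [F FD _] := facet_exists x e_irr.
have f0 : f != 0.
  apply: contraNneq p1 => f0; apply/pE.
  by rewrite /colon f0 mulr0; apply: ideal0 cover_ideal_ideal.
(* [I] is contained in [p], so [p] contains a product of variables, hence one of them. *)
have [i Xip] : exists i, 'X_i \in p.
  apply/existsP; have : sqfree K (~: F) \in p.
    apply/pE; rewrite /colon mulrC; apply: idealMl; first exact: cover_ideal_ideal.
    exact: cover_ideal_facet.
  apply: contraLR => /existsPn Xp; rewrite /sqfree.
  elim/big_rec: _ => // j g _ gp; apply/negP => /primep/orP[]; apply/negP => //.
rewrite leq_subLR; apply: (cover_ideal_degree (f := 'X_i * f)) => //.
- exact/pE.
- by apply: (@in_degreeM _ _ 1%N d) => //; rewrite /= dhomogX /= mdeg1.
- by rewrite mulf_neq0 ?mpolyX_neq0.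
Qed.

Lemma v_witness_alpha0 : symmetric e -> irreflexive e -> (exists x y, e x y) ->
  pure D -> shellable D -> v_witness I (a - 1).
Proof.
move=> e_sym e_irr e_edge pureD shD.
have [F [H [u [v [FD HD FH HF euv]]]]] := adjacent_facets e_sym e_irr e_edge pureD shD.
have mem_set1 (A B : {set 'I_s}) w : A :\: B = [set w] ->
    w \in A /\ ~: B = w |: ~: (A :|: B).
  move=> AB; have := set11 w; rewrite -AB inE => /andP[wB wA]; split=> //.
  apply/setP => z; rewrite !inE; have /setP/(_ z) := AB; rewrite !inE.
  by case: (z == w); case: (z \in A); case: (z \in B).
have [uF HC] := mem_set1 _ _ _ FH; have [vH FC] := mem_set1 _ _ _ HF.
(* The complements of [H] and [F] are [u |: B] and [v |: B]. *)
rewrite [H :|: F]setUC in FC; set B := ~: (F :|: H) in HC FC.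
have uB : u \notin B by rewrite !inE uF.
have vB : v \notin B by rewrite !inE vH orbT.
have cardB : (a - 1)%N = #|B|.
  by rewrite -(card_min_vertex_cover pureD FD) FC cardsU1 vB add1n subn1.
pose A := mem [:: u; v]; pose p : {pred S} := [pred g | kill A g == 0].
(* No facet contains both ends of the edge, so every generator is divisible by one of the two
   variables. *)
have killI g : I g -> kill A g = 0.
  apply: (cover_ideal_min (J := fun g => kill A g = 0)) => [|E ED].
    split=> [|b h1 h2]; first by rewrite kill0.
    by rewrite killD killM => -> ->; rewrite mulr0 addr0.
  apply/eqP; rewrite kill_sqfree; apply/existsP.
  have [/stableP sE _] := facetsP _ _ ED.
  have [uE|uE] := boolP (u \in E); last by exists u; rewrite !inE uE eqxx.
  exists v; rewrite !inE eqxx orbT andbT.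
  by apply/negP => vE; have := sE u v uE vE; rewrite euv.
have colonE g : colon I (sqfree K B) g <-> g \in p.
  rewrite inE; split=> [/killI/eqP|/eqP g0].
    rewrite killM mulf_eq0 kill_sqfree => /orP[] // /existsP[w /andP[wB]].
    by rewrite !inE => /orP[] /eqP wE; [rewrite wE (negPf uB) in wB | rewrite wE (negPf vB) in wB].
  rewrite -[g]subr0 -g0; apply: kill_congr => [|w].
    exact: is_ideal_colon cover_ideal_ideal.
  rewrite !inE /colon => /orP[] /eqP->; rewrite -sqfree_setU1 // -?HC -?FC;
    exact: cover_ideal_facet.
have primep : prime_ideal p.
  split=> [|g h].
    split=> [||b g h]; first by rewrite inE kill0.
      by rewrite inE kill1 oner_eq0.
    by rewrite !inE => /eqP g0 /eqP h0; rewrite killD killM g0 h0 mulr0 addr0.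
  by rewrite !inE killM mulf_eq0.
exists (sqfree K B); first by rewrite cardB; exact: in_degree_sqfree.
by exists p => //; split=> //; exists (sqfree K B).
Qed.

(** Induction on prefixes of the shelling, reversed because [linear_quotients] adds generators
    starting from the end of the list. *)
Lemma shelling_linear_quotients (Fs : seq {set 'I_s}) : shelling Fs ->
  linear_quotients [seq sqfree K (~: F) | F <- rev Fs].
Proof.
move=> shFs; rewrite -[Fs]take_size; elim: {-2}(size Fs) (leqnn (size Fs)) => [|k IHk] ltk.
  by rewrite take0.
rewrite (take_nth set0) // rev_rcons /=; split; last exact/IHk/ltnW.
set Fk := nth set0 Fs k.
(* These variables generate the colon ideal: they are the single vertices by which [Fk] exceeds an
   earlier facet. *)
pose L := [seq v <- enum 'I_s | has (fun l => Fk :\: nth set0 Fs l == [set v]) (iota 0 k)].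
have mem_nth_take l : (l < k)%N ->
    ~: nth set0 Fs l \in [seq ~: F | F <- rev (take k Fs)].
  move=> ltl; rewrite map_f // mem_rev -(nth_take _ ltl) mem_nth //.
  by rewrite size_takel // ltnW.
exists L; first by rewrite filter_uniq ?enum_uniq.
rewrite (map_comp (@sqfree K s) (fun F => ~: F)); apply: colon_sqfree => [v|C].
  rewrite mem_filter => /andP[/hasP[l]]; rewrite mem_iota => /andP[_ ltl] /eqP Fkl _.
  have /andP[_ vk] : (v \notin nth set0 Fs l) && (v \in Fk).
    by have := set11 v; rewrite -Fkl inE.
  split; first by rewrite inE vk.
  exists (~: nth set0 Fs l); first exact: mem_nth_take.
  apply/subsetP => z; rewrite !inE => zl.
  have [zk|//] := boolP (z \in Fk); last by rewrite orbT.
  have : z \in Fk :\: nth set0 Fs l by rewrite inE zl.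
  by rewrite Fkl inE => ->.
case/mapP=> F; rewrite mem_rev => /(nthP set0)[i].
rewrite size_takel ?(ltnW ltk) // => lti; rewrite nth_take // => <- ->.
have [|v vik [l ltl Fkl]] := shFs i k; first by rewrite lti.
exists v; last by move: vik; rewrite !inE => /andP[].
rewrite mem_filter mem_enum andbT; apply/hasP; exists l; rewrite ?mem_iota //.
by apply/eqP.
Qed.

Lemma cover_ideal_linear_resolution : pure D -> shellable D ->
  exists F, linear_resolution a I F.
Proof.
move=> pureD [Fs [_ FsE shFs]].
have [|F linF] := linear_quotients_resolution _ (shelling_linear_quotients shFs) (a := a).
  move=> t /mapP[F]; rewrite mem_rev FsE => FD ->.
  by rewrite -(card_min_vertex_cover pureD FD); exact: in_degree_sqfree.
exists F; apply: linear_resolution_ext linF; apply: ideal_gen_ext => t.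
split=> [/mapP[G]|[C minC ->]].
  by rewrite mem_rev FsE -min_vertex_coverC => minG ->; exists (~: G).
apply/mapP; exists (~: C); last by rewrite setCK.
by rewrite mem_rev FsE -min_vertex_coverC setCK.
Qed.

End CoverIdeal.

Theorem proposition3p18 (K : fieldType) (s : nat) (e : rel 'I_s)
    (e_sym : symmetric e) (e_irr : irreflexive e)
    (e_edge : exists x y, e x y)
    (D_pure : pure (independence_complex e))
    (D_shellable : shellable (independence_complex e)) :
  is_v_number (@cover_ideal K s e) (alpha0 e - 1)%N /\
  is_regularity (@cover_ideal K s e) ((alpha0 e)%:Z - 1).
Proof.
split.
  split; first exact: v_witness_alpha0.
  by move=> d; apply: v_witness_le.
have a0 := alpha0_gt0 e_edge; have idI := cover_ideal_ideal K e.
have [F linF] := cover_ideal_linear_resolution K D_pure D_shellable.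
apply: (linear_resolution_regularity a0 idI _ linF).
  exact: homogeneous_cover_ideal.
have [x _] := e_edge; have [E ED _] := facet_exists x e_irr.
have [_ exF _ _] := linF; apply: (rank1_gt0 idI exF) (cover_ideal_facet K ED) _.
  exact: sqfree_neq0.
(* Nonzero homogeneous elements of the ideal have degree at least [alpha0 e], which is positive, so
   1 is not among them. *)
move=> I1; have := cover_ideal_degree D_pure I1 (in_degree1 K s).
by rewrite oner_eq0 leqNgt a0 => /(_ isT).
Qed.
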